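(* Let $X$ and $Y$ be Hausdorff spaces and let $f:X\to Y$ be a continuous surjection that is closed and sequence-covering, where $X$ is a regular space with a point-countable base. Then $f$ is a 1-sequence-covering map.
   Context: A base is *point-countable* if each point belongs to at most countably many of its members. A map $f:X\to Y$ is *sequence-covering* if whenever $\{y_n\}$ is a convergent sequence in $Y$ there is a convergent sequence $\{x_n\}$ in $X$ with $x_n\in f^{-1}(y_n)$ for each $n$. $f$ is *1-sequence-covering* if for each $y\in Y$ there is $x\in f^{-1}(y)$ such that whenever $\{y_n\}$ is a sequence converging to $y$ in $Y$ there is a sequence $\{x_n\}$ converging to $x$ in $X$ with $x_n\in f^{-1}(y_n)$ for each $n$. *)

(* Defs.v *)
From mathcomp Require Import all_boot all_classical topology.

Set Implicit Arguments.
Unset Strict Implicit.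
Unset Printing Implicit Defensive.

Local Open Scope classical_set_scope.

Definition point_countable (X : Type) (B : set (set X)) : Prop :=
  forall x : X, countable [set U | B U /\ U x].

Definition has_point_countable_base (X : topologicalType) : Prop :=
  exists2 B : set (set X), basis B & point_countable B.

(* Used instead of [cvgn u], which requires a pointed space. *)
Definition convergent_seq (X : topologicalType) (u : nat -> X) : Prop :=
  exists l : X, u @ \oo --> l.

Definition closed_map (X Y : topologicalType) (f : X -> Y) : Prop :=
  forall A : set X, closed A -> closed (f @` A).

Definition sequence_covering (X Y : topologicalType) (f : X -> Y) : Prop :=
  forall y_ : nat -> Y, convergent_seq y_ ->
    exists2 x_ : nat -> X, convergent_seq x_ &
      forall n, (f @^-1` [set y_ n]) (x_ n).

Definition one_sequence_covering (X Y : topologicalType) (f : X -> Y) : Prop :=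
  forall y : Y, exists2 x : X, (f @^-1` [set y]) x &
    forall y_ : nat -> Y, y_ @ \oo --> y ->
      exists2 x_ : nat -> X, x_ @ \oo --> x &
        forall n, (f @^-1` [set y_ n]) (x_ n).

(* Main.v *)
(** Suppose that no point of the fibre of [y] witnesses 1-sequence-covering.
    By regularity and first countability, the fibre is then covered by the
    family [C] of the basic sets [V] whose closure lies in an open [U] such
    that [f U] misses some sequence [S] converging to [y].  Fix one such
    sequence [S0].  Lifting an interleaving of [S0] with the sequences of
    finitely many members of [C] gives a convergent sequence whose limit lies
    in none of the corresponding [U]s, hence points over late terms of [S0]
    lying outside those members of [C].  As in Mishchenko's argument,
    point-countability yields points [p k] over terms of [S0] such that every
    member of [C] containing some [p i] misses almost all [p k].  Since [f] is
    closed, the closure of the [p k] meets the fibre of [y], at a point covered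
    by a member of [C], which must contain infinitely many [p k]. *)
Require Import Defs.
From mathcomp Require Import all_boot all_classical topology.

Local Open Scope classical_set_scope.

(** The default [d] makes the enumeration total even for empty [A], with all entries still in
    [D]. *)
Lemma countable_enum_in {T : Type} (A D : set T) (d : T) :
  D d -> A `<=` D -> countable A ->
  exists2 e : nat -> T, (forall j, D (e j)) & A `<=` range e.
Proof.
move=> Dd AD /countable_injP[f finj].
have /choice[e he] (j : nat) : exists a, D a /\ forall b, A b -> f b = j -> b = a.
  have [[a [Aa faj]]|noa] := pselect (exists a, A a /\ f a = j).
    exists a; split; first exact: AD.
    by move=> b Ab fbj; apply: finj; rewrite ?inE // fbj.
  by exists d; split=> // b Ab fbj; case: noa; exists b.
exists e => [j|a Aa]; first by have [] := he j.
by exists (f a) => //; rewrite -(proj2 (he (f a)) _ Aa).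
Qed.

(** Course-of-values recursion: [h k] carries the list of the first [k] values. *)
Lemma exists_recursive_seq {T : Type} (g : seq T -> T) :
  exists p : nat -> T, forall k, p k = g (mkseq p k).
Proof.
pose h := fix h k := if k is k'.+1 then rcons (h k') (g (h k')) else [::].
exists (fun k => g (h k)) => k; congr g.
by elim: k => //= k IH; rewrite mkseqS -IH.
Qed.

Lemma first_countable_point {X : topologicalType} (x : X) :
  has_point_countable_base X ->
  exists2 U : nat -> set X, (forall k, nbhs x (U k)) &
    forall W, nbhs x W -> exists k, U k `<=` W.
Proof.
move=> [B [Bop Bnb] Bpc].
have [V [BV Vx] _] := Bnb x _ filterT.
have [e he Be] := @countable_enum_in _ _ [set U | B U /\ U x] V
  (conj BV Vx) (fun _ h => h) (Bpc x).
exists e => [k|W /Bnb[U hU UW]].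
  by have [Bk kx] := he k; apply: open_nbhs_nbhs; split=> //; exact: Bop.
by have [k _ ek] := Be _ hU; exists k; rewrite ek.
Qed.

(** By contraposition, a fibre point that is no witness has a neighbourhood whose image misses
    infinitely many terms of some sequence converging to [y]. *)
Lemma lift_convergent_seq {X Y : topologicalType} (f : X -> Y) (x : X)
    (y_ : nat -> Y) :
  has_point_countable_base X -> set_surj [set: X] [set: Y] f ->
  (forall U, nbhs x U -> \forall n \near \oo, (f @` U) (y_ n)) ->
  exists2 x_ : nat -> X, x_ @ \oo --> x & forall n, f (x_ n) = y_ n.
Proof.
move=> pcb fsurj yU.
have [V Vnb Vbase] := first_countable_point x pcb.
pose U k := \bigcap_(i in [set i | (i <= k)%N]) V i.
have Unb k : nbhs x (U k).
  elim: k => [|k IH].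
    by apply: filterS (Vnb 0%N) => z Vz i /=; rewrite leqn0 => /eqP ->.
  apply: filterS2 IH (Vnb k.+1) => z Uz Vz i /=.
  by rewrite leq_eqVlt => /orP[/eqP ->//|]; rewrite ltnS => /Uz.
have Udec i k : (i <= k)%N -> U k `<=` U i.
  by move=> ik z Uz j /= ji; apply: Uz; exact: leq_trans ik.
(* [x_ n] is taken over [y_ n] in [U k] for the largest suitable [k <= n]. *)
have /choice[x_ hx] (n : nat) : exists z, f z = y_ n /\
    forall k, (k <= n)%N -> (f @` U k) (y_ n) -> U k z.
  have aux m : exists z, f z = y_ n /\
      forall k, (k < m)%N -> (f @` U k) (y_ n) -> U k z.
    elim: m => [|m [z [fz hz]]].
      by have [z _ fz] := fsurj (y_ n) I; exists z.
    have [[w Uw fw]|nU] := pselect ((f @` U m) (y_ n)).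
      exists w; split=> // k; rewrite ltnS => km _; exact: Udec Uw.
    exists z; split=> // k; rewrite ltnS leq_eqVlt => /orP[/eqP ->//|].
    exact: hz.
  exact: aux n.+1.
exists x_ => [W /Vbase[k VW]|n]; last by have [] := hx n.
have kU : \forall n \near \oo, (f @` U k) (y_ n) by exact: yU.
have kn : \forall n \near \oo, (k <= n)%N by exists k.
apply: filterS2 kU kn => n yn kn; apply: VW.
by have [_ /(_ _ kn yn) Uk] := hx n; apply: Uk => /=.
Qed.

(** Interleave by residues modulo [r.+1], keeping each term at its own index. *)
Lemma merge_convergent_seqs {Y : topologicalType} (y : Y)
    (S : nat -> nat -> Y) (r : nat) :
  (forall i, S i @ \oo --> y) ->
  exists2 T : nat -> Y, T @ \oo --> y &
    forall i N, (i <= r)%N -> exists2 n, (N <= n)%N & T n = S i n.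
Proof.
move=> Sy; exists (fun n => S (n %% r.+1)%N n) => [W Wy|i N ir].
  have : \forall n \near \oo, forall i : 'I_r.+1, W (S i n).
    by apply: filter_forall => i; exact: Sy.
  apply: filterS => n Wn; exact: (Wn (Ordinal (ltn_pmod n (ltn0Sn r)))).
exists (N * r.+1 + i)%N.
  by rewrite (leq_trans (leq_pmulr N (ltn0Sn r))) ?leq_addr.
by rewrite modnMDl modn_small.
Qed.

Lemma subsequence_avoiding {Y : topologicalType} (y : Y) (A : set Y)
    (y_ : nat -> Y) :
  y_ @ \oo --> y -> ~ (\forall n \near \oo, A (y_ n)) ->
  exists2 S : nat -> Y, S @ \oo --> y & forall n, ~ A (S n).
Proof.
move=> yy nA.
have /choice[g hg] (N : nat) : exists n, (N <= n)%N /\ ~ A (y_ n).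
  apply: contrapT => no; apply: nA; exists N => // n /= Nn.
  by apply: contrapT => nAn; apply: no; exists n.
exists (fun n => y_ (g n)) => [W /yy[N _ NW]|n]; last by case: (hg n).
by exists N => // n /= Nn; apply: NW => /=; apply: leq_trans Nn (proj1 (hg n)).
Qed.

Theorem corollary5p5 (X Y : topologicalType) (f : X -> Y)
    (hausX : hausdorff_space X) (hausY : hausdorff_space Y)
    (f_cont : continuous f) (f_surj : set_surj [set: X] [set: Y] f)
    (f_closed : closed_map f) (f_seqcov : sequence_covering f)
    (regX : regular_space X) (pcbX : has_point_countable_base X) :
  one_sequence_covering f.
Proof.
move=> y; apply: contrapT => nogood.
have [B [Bop Bnb] Bpc] := pcbX.
pose C := [set V | B V /\ exists U (S : nat -> Y),
  [/\ open U, closure V `<=` U, S @ \oo --> y & forall n, ~ (f @` U) (S n)]].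
have Ccover x : f x = y -> exists2 V, C V & V x.
  move=> fx.
  have [y_ [yy [U Unb nU]]] : exists y_ : nat -> Y, y_ @ \oo --> y /\
      exists2 U, nbhs x U & ~ (\forall n \near \oo, (f @` U) (y_ n)).
    apply: contrapT => no; apply: nogood; exists x => // y_ yy.
    apply: lift_convergent_seq => // U Unb; apply: contrapT => nU.
    by apply: no; exists y_; split=> //; exists U.
  have [S Sy SU] := subsequence_avoiding _ _ _ yy nU.
  have /regX[W Wnb WU] : nbhs x U° by apply: nbhs_interior.
  have [V [BV Vx] VW] := Bnb x _ Wnb.
  exists V => //; split=> //; exists U°, S; split=> //.
  - exact: open_interior.
  - exact: subset_trans (closureS VW) WU.
  - by move=> n [z /interior_subset Uz fz]; apply: (SU n); exists z.
have [x0 _ fx0] := f_surj y I.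
have [V0 CV0 V0x0] := Ccover _ fx0.
have [_ [U0 [S0 [_ VU0 S0y S0U]]]] := CV0.
have S0neq n : S0 n <> y.
  move=> S0n; apply: (S0U n); exists x0; rewrite ?fx0 //.
  exact/VU0/subset_closure.
have avoid (V : nat -> set X) (r : nat) : (forall i, C (V i)) ->
    exists p, (exists2 m, (r <= m)%N & f p = S0 m) /\
      forall i, (i < r)%N -> ~ V i p.
  move=> CV.
  have /choice[U /choice[S hS]] i : exists U (S : nat -> Y),
      [/\ open U, closure (V i) `<=` U, S @ \oo --> y & forall n, ~ (f @` U) (S n)].
    by have [_] := CV i.
  (* Slot 0 is reserved for [S0]; the sequence of [V i] sits at [i.+1], hence the bound [i < r]
     below. *)
  pose S' i := if i is j.+1 then S j else S0.
  have [T Ty hT] : exists2 T : nat -> Y, T @ \oo --> y &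
      forall i N, (i <= r)%N -> exists2 n, (N <= n)%N & T n = S' i n.
    by apply: merge_convergent_seqs => -[|i] //=; case: (hS i).
  have [x_ [z xz] fx_] := f_seqcov T (ex_intro _ y Ty).
  have away i : (i < r)%N -> \forall n \near \oo, ~ V i (x_ n).
    move=> ir; have [Uop VU _ SU] := hS i.
    have nUz : ~ U i z.
      move=> Uz.
      have [N _ NU] := xz _ (open_nbhs_nbhs (conj Uop Uz)).
      have [n Nn Tn] := hT i.+1 N ir.
      apply: (SU n); exists (x_ n); first exact: NU.
      by rewrite -[RHS]Tn; exact: fx_.
    have : nbhs z (~` closure (V i)).
      apply: open_nbhs_nbhs; split; last by move=> /VU.
      by apply: closed_openC; exact: closed_closure.
    move=> /xz[N _ HN]; exists N => // n /HN.
    by apply: contra_not; exact: subset_closure.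
  have [N _ HN] : \forall n \near \oo, forall i : 'I_r, ~ V i (x_ n).
    by apply: filter_forall => i; exact: away.
  have [n Nn Tn] := hT 0%N (maxn N r) (leq0n _).
  move: Nn; rewrite geq_max => /andP[Nn rn].
  exists (x_ n); split; first by exists n => //; rewrite -[RHS]Tn; exact: fx_.
  by move=> i ir; exact: (HN n Nn (Ordinal ir)).
have /choice[e he] (x : X) : exists e : nat -> set X,
    (forall j, C (e j)) /\ [set V | C V /\ V x] `<=` range e.
  have [||e ? ?] := @countable_enum_in _ [set V | C V /\ V x] C V0 CV0.
  - by move=> V [].
  - by apply: sub_countable (Bpc x); apply: subset_card_le => V [[BV _] Vx].
  - by exists e.
(* Stage [k] must avoid [e (p i) j] for all pairs with [i < k] and code below [k]. A decoded first
   index beyond the list falls back to [x0], which still yields a member of [C]. *)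
pose code i := odflt (0%N, 0%N) (unpickle i : option (nat * nat)).
have /choice[g hg] (s : seq X) := avoid
  (fun i => e (nth x0 s (code i).1) (code i).2) (size s)
  (fun i => proj1 (he _) _).
have [p hp] := exists_recursive_seq g.
have p_fiber k : exists2 m, (k <= m)%N & f (p k) = S0 m.
  by have [+ _] := hg (mkseq p k); rewrite size_mkseq -hp.
have p_avoid i j k : (i < k)%N -> (pickle (i, j) < k)%N -> ~ e (p i) j (p k).
  move=> ik ck; have [_] := hg (mkseq p k).
  by rewrite size_mkseq -hp => /(_ _ ck); rewrite /code pickleK /= nth_mkseq.
have fpy : (f \o p) @ \oo --> y.
  move=> W /S0y[N _ NW]; exists N => // k /= Nk.
  by have [m km ->] := p_fiber k; apply: NW => /=; exact: leq_trans km.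
have [z zcl fz] : (f @` closure (range p)) y.
  have /closure_id -> := f_closed _ (@closed_closure _ (range p)).
  move=> W /fpy[N _ NW]; exists (f (p N)); split; last exact: (NW N (leqnn N)).
  by exists (p N) => //; apply: subset_closure; exists N.
have [V CV Vz] := Ccover z fz.
have Vnb : nbhs z V by apply: open_nbhs_nbhs; split=> //; apply: Bop; case: CV.
have [_ [[i _ <-] Vpi]] := zcl V Vnb.
have [j _ ej] := proj2 (he (p i)) V (conj CV Vpi).
(* From [K] on, [p_avoid] keeps [p k] out of [V]. The earlier [p l] can be removed from [V]: they
   lie over terms of [S0], never equal to [y], so differ from [z]. *)
pose K := (maxn i (pickle (i, j))).+1.
have [|_ [[k _ <-] [Vpk pk]]] :=
    zcl (V `&` [set x | forall l : 'I_K, x <> p l]).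
  apply: filterI => //; apply: filter_forall => l.
  apply: (@open_nbhs_nbhs _ z (~` [set p l])); split.
    exact/closed_openC/accessible_closed_set1/hausdorff_accessible.
  move=> /= zl; have [m _] := p_fiber l; rewrite -zl fz => /esym; exact: S0neq.
have [kK|Kk] := ltnP k K; first exact: (pk (Ordinal kK)).
move: Kk; rewrite /K -maxnSS geq_max => /andP[ik ck].
by apply: (p_avoid i j k ik ck); rewrite ej.
Qed.
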